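(* Let $(X,\mathcal{X},\mu,T)$ be a measure preserving system with singular maximal spectral type (with respect to the Lebesgue measure on $\mathbb{T}$). Then the system has no under-recurrent functions, and in fact, for every non-constant $f\in L^2(\mu)$ we have $$\int f\cdot T^nf\,d\mu>\Big(\int f\,d\mu\Big)^2$$ for infinitely many $n\in\mathbb{N}$.
   Context: A measure preserving system is a quadruple $(X,\mathcal{X},\mu,T)$ where $(X,\mathcal{X},\mu)$ is a probability space and $T\colon X\to X$ is a measure preserving transformation. All functions are real valued and $T^nf$ denotes $f\circ T^n$; non-constant is understood modulo $\mu$-null sets. $\mathbb{N}=\{1,2,\ldots\}$ and $\mathbb{T}=\mathbb{R}/\mathbb{Z}$. The spectral measure of $f\in L^2(\mu)$ is the symmetric finite positive Borel measure $\sigma_f$ on $\mathbb{T}$ with $\int e^{2\pi int}\,d\sigma_f(t)=\int f\cdot T^nf\,d\mu$ for $n=0,1,2,\ldots$. Singular maximal spectral type means that for every $f\in L^2(\mu)$ the measure $\sigma_f$ is singular with respect to the Lebesgue measure on $\mathbb{T}$. A function $f\in L^2(\mu)$ is under-recurrent if it is non-constant and $\int f\cdot T^nf\,d\mu\leq\left(\int f\,d\mu\right)^2$ for every $n\in\mathbb{N}$. *)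

(* Defs.v *)
From HB Require Import structures.
From mathcomp Require Import all_boot all_order all_algebra archimedean.
From mathcomp Require Import generic_quotient ring_quotient.
From mathcomp Require Import all_classical all_reals all_analysis.

Set Implicit Arguments.
Unset Strict Implicit.
Unset Printing Implicit Defensive.

Import Order.TTheory GRing.Theory Num.Theory.
Import numFieldNormedType.Exports.

Local Open Scope classical_set_scope.
Local Open Scope ring_scope.
Local Open Scope quotient_scope.

(* R/Z as a quotient group (Num.int_num_subdef is the predicate underlying
   Num.int), with the Borel sigma-algebra of the quotient topology. *)
Section circle.
Variable R : realType.

Definition circle_group :=
  ring_quotient.Quotient.quot (GRing.ZmodClosed.clone R Num.int_num_subdef _).

Definition circle : Type := circle_group.

HB.instance Definition _ := GRing.Zmodule.on circle.
HB.instance Definition _ := generic_quotient.Quotient.on circle.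
HB.instance Definition _ := isPointed.Build circle 0.

Let circle_open : set (set circle) := @open (quotient_topology circle_group).

HB.instance Definition _ := @isMeasurable.Build (sigma_display circle_open)
  circle <<s circle_open >> (@sigma_algebra0 _ setT circle_open)
  (@sigma_algebraC _ circle_open) (@sigma_algebra_bigcup _ setT circle_open).

Definition to_circle (x : measurableTypeR R) : circle := \pi_circle x.

Lemma reprK_circle (t : circle) : to_circle (repr t) = t.
Proof. exact: reprK. Qed.

Lemma to_circle_eq (x y : R) :
  to_circle x = to_circle y <-> x - y \is a Num.int.
Proof.
have -> : (x - y \is a Num.int) = (x == y %[mod circle_group]).
  by rewrite -ring_quotient.Quotient.idealrBE.
by split=> /eqP.
Qed.

Lemma to_circleN (x : R) : to_circle (- x) = - to_circle x.
Proof. exact: ring_quotient.Quotient.pi_opp. Qed.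

Lemma to_circleD (x y : R) : to_circle (x + y) = to_circle x + to_circle y.
Proof. exact: ring_quotient.Quotient.pi_add. Qed.

Lemma measurable_to_circle : measurable_fun setT to_circle.
Proof.
have := @measurability _ _ (measurableTypeR R) circle setT to_circle
  circle_open.
apply=> [|A]; first by [].
case=> B oB <-; rewrite setTI.
exact: measurable_realfun.open_measurable.
Qed.

HB.instance Definition _ :=
  @isMeasurableFun.Build _ _ _ _ to_circle measurable_to_circle.

Definition circle_lebesgue (A : set circle) : \bar R :=
  lebesgue_measure (to_circle @^-1` A `&` `[0%R, 1%R[).

Let circle_lebesgue0 : circle_lebesgue set0 = 0%E.
Proof. by rewrite /circle_lebesgue preimage_set0 set0I measure0. Qed.

Let circle_lebesgue_ge0 A : (0 <= circle_lebesgue A)%E.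
Proof. exact: measure_ge0. Qed.

Let circle_lebesgue_sigma_additive : semi_sigma_additive circle_lebesgue.
Proof.
have mpre A : measurable A -> measurable (to_circle @^-1` A).
  by move=> mA; rewrite -[X in measurable X]setTI; exact: measurable_to_circle.
move=> F mF tF mUF; rewrite /circle_lebesgue preimage_bigcup.
apply: (@measure_semi_sigma_additive _ _ _
  (mrestr (@lebesgue_measure R) (measurable_itv `[0%R, 1%R[))).
- by move=> n; exact: mpre.
- apply/trivIsetP => i j _ _ ij; rewrite -preimage_setI.
  by move/trivIsetP : tF => /(_ _ _ _ _ ij) ->//; rewrite preimage_set0.
- by rewrite -preimage_bigcup; exact: mpre.
Qed.

HB.instance Definition _ := isMeasure.Build _ _ _ circle_lebesgue
  circle_lebesgue0 circle_lebesgue_ge0 circle_lebesgue_sigma_additive.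

Let circle_lebesgue_setT : circle_lebesgue setT = 1%E.
Proof.
rewrite /circle_lebesgue preimage_setT setTI.
by rewrite lebesgue_measure_itv/= lte_fin ltr01 oppr0 adde0.
Qed.

HB.instance Definition _ :=
  Measure_isProbability.Build _ _ _ circle_lebesgue circle_lebesgue_setT.

(* Real and imaginary parts of t |-> e^{2 pi i n t} on R/Z; circle_cos_to_circle
   and circle_sin_to_circle show independence of the representative. *)
Definition circle_cos (n : nat) (t : circle) : R :=
  cos (2 * pi * n%:R * repr t).
Definition circle_sin (n : nat) (t : circle) : R :=
  sin (2 * pi * n%:R * repr t).

Let periodic_to_circle (g : R -> R) (n : nat) (x : R) :
  periodic g (pi *+ 2) ->
  g (2 * pi * n%:R * repr (to_circle x)) = g (2 * pi * n%:R * x).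
Proof.
move=> gP.
have gZ (m : int) a : g (a + (pi *+ 2) * m%:~R) = g a.
  case: m => m; first by rewrite -pmulrn mulr_natr (periodicn gP).
  rewrite NegzE mulrNz mulrN -pmulrn mulr_natr.
  by rewrite -[a in RHS](subrK (pi *+ 2 *+ m.+1)) (periodicn gP).
have /to_circle_eq/intrP[m rE] := reprK_circle (to_circle x).
have -> : repr (to_circle x) = x + m%:~R by rewrite -rE addrC subrK.
rewrite mulrDr -[RHS](gZ (n%:Z * m)) intrM; congr (g (_ + _)).
by rewrite -(mulr_natl pi 2) mulrA.
Qed.

Lemma circle_cos_to_circle n x :
  circle_cos n (to_circle x) = cos (2 * pi * n%:R * x).
Proof. exact/periodic_to_circle/cosD2pi. Qed.

Lemma circle_sin_to_circle n x :
  circle_sin n (to_circle x) = sin (2 * pi * n%:R * x).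
Proof. exact/periodic_to_circle/sinD2pi. Qed.

Let measurable_lift (g : R -> R) (h : circle -> R) :
  continuous g -> (forall x, h (to_circle x) = g x) -> measurable_fun setT h.
Proof.
move=> cg hg.
have := @measurability _ _ circle (measurableTypeR R) setT h _
  (measurable_realfun.RGenOpens.measurableE R).
apply=> A; case=> _ [a [b ->]] <-; rewrite setTI.
apply: sub_sigma_algebra; rewrite /circle_open/=.
rewrite /open/= /quotient_open.
suff -> : \pi_(quotient_topology circle_group) @^-1` (h @^-1` `]a, b[) =
          g @^-1` `]a, b[ by move/continuousP: cg; apply; exact: interval_open.
by apply/seteqP; split=> x /=; rewrite -hg.
Qed.

Lemma measurable_circle_cos n : measurable_fun setT (circle_cos n).
Proof.
apply: measurable_lift (circle_cos_to_circle n) => x.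
by apply: continuous_comp; [exact: mulrl_continuous|exact: continuous_cos].
Qed.

Lemma measurable_circle_sin n : measurable_fun setT (circle_sin n).
Proof.
apply: measurable_lift (circle_sin_to_circle n) => x.
by apply: continuous_comp; [exact: mulrl_continuous|exact: continuous_sin].
Qed.

End circle.

Definition mutually_singular d (T : measurableType d) (R : realType)
    (mu nu : {measure set T -> \bar R}) :=
  exists A : set T, [/\ measurable A, mu A = 0%E & nu (~` A) = 0%E].

Section measure_preserving_system.
Context d (X : measurableType d) (R : realType).
Variables (mu : probability X R) (T : X -> X).

Definition measure_preserving :=
  measurable_fun setT T /\ forall A, measurable A -> mu (T @^-1` A) = mu A.

Definition correlation (f : X -> R) (n : nat) : R :=
  \int[mu]_x (f x * f (iter n T x)).

Definition ae_constant (f : X -> R) :=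
  exists c : R, {ae mu, forall x, f x = c}.

Definition is_spectral_measure (f : X -> R)
    (sigma : {finite_measure set (circle R) -> \bar R}) :=
  (forall A : set (circle R), measurable A ->
     sigma ((fun t : circle R => - t) @^-1` A) = sigma A) /\
  forall n : nat,
    \int[sigma]_t circle_cos n t = correlation f n /\
    \int[sigma]_t circle_sin n t = 0.

(* The spectral measure of f exists and is unique (Herglotz), so quantifying
   over all the measures that satisfy its defining property refers to it. *)
Definition singular_maximal_spectral_type :=
  forall f : X -> R, f \in Lfun mu 2%:E ->
  forall sigma : {finite_measure set (circle R) -> \bar R},
    is_spectral_measure f sigma ->
    mutually_singular sigma (@circle_lebesgue R).

Definition under_recurrent (f : X -> R) :=
  [/\ f \in Lfun mu 2%:E, ~ ae_constant f &
      forall n : nat, (0 < n)%N ->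
        correlation f n <= (\int[mu]_x f x) ^+ 2].

End measure_preserving_system.

(* Main.v *)
From HB Require Import structures.
Require Import Defs.
From mathcomp Require Import all_boot all_order all_algebra.
From mathcomp Require Import generic_quotient ring lra.
From mathcomp Require Import all_classical all_reals all_analysis.
From mathcomp Require Import measurable_realfun.

(** Centre f to g := f - int f and write c n for the correlations of g, so that
    c n = int f T^n f - (int f)^2. If only finitely many c n were positive, put
      S_m(t) := c 0 + 2 sum_(1 <= k <= m) c k cos(2 pi k t).
    By stationarity of the process g o T^j, the Cesaro means of S_m(t) are
    nonnegative. At t = 0 the sequence S_m is eventually nonincreasing, so
    nonnegativity of its means forces S_m(0) >= 0 for large m, i.e. c is
    absolutely summable. Hence S_m converges boundedly to some phi >= 0, and
    phi dt is the spectral measure of g. Being both absolutely continuous and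
    singular it vanishes, so c 0 = int g^2 = 0 and f is constant. The explicit
    density phi takes the place of Herglotz's theorem. *)

Set Implicit Arguments.
Unset Strict Implicit.
Unset Printing Implicit Defensive.

Import Order.TTheory GRing.Theory Num.Theory.
Import numFieldNormedType.Exports.
Local Open Scope classical_set_scope.
Local Open Scope ring_scope.

(** * Invariance of Lebesgue measure on the circle under rotation and negation *)

Section circle_lebesgue_invariance.
Context {R : realType}.
Local Notation leb := (@lebesgue_measure R).
Local Open Scope quotient_scope.

(** Measurability need only be tested on the generating quotient-open sets. These are the sets whose
    pullback to the line is open, so continuity of the lift [g] suffices. *)
Lemma measurable_circle_lift (g : R -> R) (h : circle R -> circle R) :
  continuous g -> (forall x, h (to_circle x) = to_circle (g x)) ->
  measurable_fun setT h.
Proof.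
move=> cg hg.
have := @measurability _ _ (circle R) (circle R) setT h
  (@open (quotient_topology (circle_group R))).
apply=> [|A]; first by [].
case=> B oB <-; rewrite setTI; apply: sub_sigma_algebra.
move: oB; rewrite /open/= /quotient_open => oB.
suff -> : \pi_(quotient_topology (circle_group R)) @^-1` (h @^-1` B) =
    g @^-1` (\pi_(quotient_topology (circle_group R)) @^-1` B).
  by move/continuousP: cg; apply.
by apply/seteqP; split=> x /=; rewrite -[X in h X]/(to_circle x) hg.
Qed.

Lemma measurable_circle_opp : measurable_fun setT (fun t : circle R => - t).
Proof.
apply: (@measurable_circle_lift (fun x => - x)) => [x|x].
  exact: opp_continuous.
by rewrite to_circleN.
Qed.

Lemma measurable_circle_shift (a : R) :
  measurable_fun setT (fun t : circle R => t + to_circle a).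
Proof.
apply: (@measurable_circle_lift (fun x => x + a)) => [x|x].
  by apply: cvgD; [exact: cvg_id|exact: cvg_cst].
by rewrite to_circleD.
Qed.

(** By uniqueness of Lebesgue measure: its image under the translation still gives each half-open
    interval its length. *)
Lemma lebesgue_measure_shift (a : R) (A : set R) : measurable A ->
  leb ((fun x => x + a) @^-1` A) = leb A.
Proof.
move=> mA.
have ms : measurable_fun setT
    ((fun x => x + a) : measurableTypeR R -> measurableTypeR R).
  by apply: measurable_funD => //; exact: measurable_cst.
pose s : {mfun measurableTypeR R >-> measurableTypeR R} :=
  HB.pack ((fun x => x + a) : measurableTypeR R -> measurableTypeR R)
  (isMeasurableFun.Build _ _ _ _ _ ms).
rewrite -[LHS]/(pushforward leb s A).
apply/esym/lebesgue_measure_unique => //= _ [[u v]] _ <-.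
rewrite /pushforward/=.
have -> : (fun x => x + a) @^-1` `]u, v]%classic = `]u - a, v - a]%classic.
  by apply/seteqP; split=> x /=; rewrite !in_itv/= ltrBlDr lerBrDr.
rewrite !lebesgue_measure_itv/= !lte_fin ltrD2r.
by case: ifP => // _; rewrite -!EFinB; congr (_%:E); ring.
Qed.

Lemma measurable_preimage_to_circle (A : set (circle R)) : measurable A ->
  measurable (@to_circle R @^-1` A : set (measurableTypeR R)).
Proof.
by move=> mA; rewrite -[X in measurable X]setTI; exact: measurable_to_circle.
Qed.

Lemma to_circleD1 (x : R) : to_circle (x + 1) = to_circle x.
Proof. by apply/to_circle_eq; rewrite addrAC subrr add0r rpred1. Qed.

(** On the line, the rotation replaces the window [[0, 1[] by [[a, 1 + a[]; periodicity moves the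
    part over [[1, 1 + a[] back to [[0, a[]. *)
Lemma circle_lebesgue_shift (a : R) (A : set (circle R)) :
  0 <= a <= 1 -> measurable A ->
  circle_lebesgue ((fun t => t + to_circle a) @^-1` A) = circle_lebesgue A.
Proof.
move=> /andP[a0 a1] mA; rewrite /circle_lebesgue.
pose B : set R := @to_circle R @^-1` A.
have mB : measurable (B : set (measurableTypeR R)).
  exact: measurable_preimage_to_circle.
have mBI (u v : R) :
    measurable (B `&` `[u, v[%classic : set (measurableTypeR R)).
  by apply: measurableI => //; exact: measurable_itv.
have BUI (u v w : R) : u <= v -> v <= w ->
    leb (B `&` `[u, w[%classic) =
    (leb (B `&` `[u, v[%classic) + leb (B `&` `[v, w[%classic))%E.
  move=> uv vw; rewrite -measureU//.
    congr (leb _); rewrite -setIUr; congr (_ `&` _).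
    by rewrite -itv_bndbnd_setU// ?bnd_simp.
  rewrite -subset0 => x [[_]] /=; rewrite !in_itv/= => /andP[_ xv] [_].
  by rewrite leNgt xv.
have -> : @to_circle R @^-1` ((fun t => t + to_circle a) @^-1` A) `&` `[0, 1[ =
    (fun x => x + a) @^-1` (B `&` `[a, 1 + a[%classic).
  apply/seteqP; split=> x; rewrite /B /= !in_itv/= -to_circleD lerDr ltrD2r//.
rewrite lebesgue_measure_shift; last exact: mBI.
have a2 : 1 <= 1 + a by rewrite lerDl.
rewrite -/B (BUI _ _ _ a1 a2) (BUI _ _ _ a0 a1) addeC; congr (_ + _)%E.
rewrite -(lebesgue_measure_shift 1); last exact: mBI.
congr (leb _).
by apply/seteqP; split=> x; rewrite /B /= to_circleD1 !in_itv/= lerDr addrC ltrD2l.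
Qed.

Lemma circle_lebesgue_opp (A : set (circle R)) : measurable A ->
  circle_lebesgue ((fun t => - t) @^-1` A) = circle_lebesgue A.
Proof.
move=> mA; rewrite /circle_lebesgue.
pose B : set R := @to_circle R @^-1` A.
have mB : measurable (B : set (measurableTypeR R)).
  exact: measurable_preimage_to_circle.
have mBo : measurable (B `&` `]-1, 0[%classic : set (measurableTypeR R)).
  by apply: measurableI => //; exact: measurable_itv.
(* Single points are null. Used at [0] and [-1], this exchanges []-1, 0]], the mirror image of the
   window, for [[-1, 0[], which a unit translation carries to [[0, 1[]. *)
have BI1 (c : R) :
    leb (B `&` `]-1, 0[%classic `|` B `&` [set c]) =
    leb (B `&` `]-1, 0[%classic).
  apply: measureU0 => //; first by apply: measurableI => //; exact: measurable_set1.
  apply: (@subset_measure0 _ (measurableTypeR R) _ leb _ [set c]).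
  - by apply: measurableI => //; exact: measurable_set1.
  - exact: measurable_set1.
  - exact: subIsetr.
  - exact: lebesgue_measure_set1.
have -> : @to_circle R @^-1` ((fun t => - t) @^-1` A) `&` `[0, 1[ =
    (-%R : R -> measurableTypeR R) @^-1` (B `&` `]-1, 0]%classic).
  apply/seteqP; split=> x; rewrite /B /= !in_itv/= -to_circleN ltrN2 oppr_le0;
  by rewrite andbC.
rewrite -/(pushforward leb (-%R : R -> measurableTypeR R) _) lebesgue_measureN//.
  have -> : B `&` `]-1, 0]%classic = B `&` `]-1, 0[%classic `|` B `&` [set 0].
    by rewrite -setIUr setUitv1// bnd_simp ltrN10.
  rewrite BI1 -(BI1 (-1)) -setIUr setUC setU1itv ?bnd_simp ?ltrN10//.
  rewrite -(lebesgue_measure_shift (-1)).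
    congr (leb _); apply/seteqP; split=> x; rewrite /B /=;
    rewrite -(to_circleD1 (x - 1)) subrK !in_itv/=;
    by rewrite lerDr ltrBlDr add0r.
  by apply: measurableI => //; exact: measurable_itv.
by apply: measurableI => //; exact: measurable_itv.
Qed.


End circle_lebesgue_invariance.

(** * Integrability, and change of variables under measure preserving maps *)

Lemma bounded_integrable d (T : measurableType d) (R : realType)
    (mu : {finite_measure set T -> \bar R}) (f : T -> R) (M : R) :
  measurable_fun setT f -> (forall x, `|f x| <= M) ->
  mu.-integrable setT (EFin \o f).
Proof.
move=> mf fM; apply: measurable_bounded_integrable => //.
  by rewrite -ge0_fin_numE// fin_num_measure.
by exists M; split; [exact: num_real|move=> r Mr x _; exact: le_trans (ltW Mr)].
Qed.

Section measure_preserving_integral.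
Context d (X : measurableType d) (R : realType).
Variables (mu : probability X R) (T : X -> X).
Hypothesis hT : measure_preserving mu T.

Lemma integrable_measure_preserving (f : X -> \bar R) :
  mu.-integrable setT f -> mu.-integrable setT (f \o T).
Proof.
case: hT => mT invT /integrableP[mf foo]; apply/integrableP; split.
  exact: measurableT_comp.
pose T' : {mfun X >-> X} := HB.pack T (isMeasurableFun.Build _ _ _ _ _ mT).
have := @ge0_integral_pushforward _ _ _ _ R T mT mu setT (abse \o f).
rewrite preimage_setT => <- //; last 2 first.
- exact: measurableT_comp.
- by move=> y _ /=; exact: abse_ge0.
rewrite (@eq_measure_integral _ _ _ _ mu (pushforward mu T'))// => A mA _.
exact: invT.
Qed.

(** Integration against the pushforward of [mu], which agrees with [mu] on measurable sets. The set
    [D] is arbitrary because the symmetry of the spectral measure compares integrals over a set and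
    over its mirror image. *)
Lemma integral_measure_preserving (f : X -> \bar R) (D : set X) :
  mu.-integrable setT f -> measurable D ->
  (\int[mu]_(x in T @^-1` D) f (T x) = \int[mu]_(x in D) f x)%E.
Proof.
move=> intf mD; case: (hT) => mT invT.
have intfT : mu.-integrable (T @^-1` D) (f \o T).
  apply: integrableS (integrable_measure_preserving intf) => //.
  by rewrite -[X in measurable X]setTI; exact: mT.
have := integral_pushforward mT (measurable_int mu intf) intfT mD.
pose T' : {mfun X >-> X} := HB.pack T (isMeasurableFun.Build _ _ _ _ _ mT).
move=> <-.
rewrite (@eq_measure_integral _ _ _ _ mu (pushforward mu T'))// => A mA _.
exact: invT.
Qed.

Lemma Rintegral_measure_preserving (f : X -> R) :
  mu.-integrable setT (EFin \o f) ->
  \int[mu]_x f (T x) = \int[mu]_x f x.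
Proof.
move=> intf; congr fine.
by rewrite -(integral_measure_preserving intf)// preimage_setT.
Qed.

End measure_preserving_integral.

(** * Cosines and sines on the circle: parity and orthogonality *)

Section circle_trig.
Context {R : realType}.
Local Notation lam := (@circle_lebesgue R).

Lemma measure_preserving_circle_opp :
  measure_preserving lam (fun t : circle R => - t).
Proof.
by split; [exact: measurable_circle_opp|exact: circle_lebesgue_opp].
Qed.

Lemma measure_preserving_circle_shift (a : R) : 0 <= a <= 1 ->
  measure_preserving lam (fun t => t + to_circle a).
Proof.
move=> a01; split; first exact: measurable_circle_shift.
by move=> A; exact: circle_lebesgue_shift.
Qed.

Lemma circle_cosN n (t : circle R) : circle_cos n (- t) = circle_cos n t.
Proof.
rewrite -[t]reprK_circle -to_circleN !circle_cos_to_circle.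
by rewrite mulrN cosN.
Qed.

Lemma circle_sinN n (t : circle R) : circle_sin n (- t) = - circle_sin n t.
Proof.
rewrite -[t]reprK_circle -to_circleN !circle_sin_to_circle.
by rewrite mulrN sinN.
Qed.

Lemma circle_cos_le1 n (t : circle R) : `|circle_cos n t| <= 1.
Proof. by rewrite ler_norml cos_geN1 cos_le1. Qed.

Lemma circle_sin_le1 n (t : circle R) : `|circle_sin n t| <= 1.
Proof. by rewrite ler_norml sin_geN1 sin_le1. Qed.

Lemma circle_cos0 (t : circle R) : circle_cos 0 t = 1.
Proof. by rewrite /circle_cos mulr0 mul0r cos0. Qed.

(** The condition [m <= n] makes the natural subtraction [n - m] the true difference of
    frequencies. *)
Lemma circle_cosM (m n : nat) (t : circle R) : (m <= n)%N ->
  circle_cos m t * circle_cos n t =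
  2^-1 * (circle_cos (n + m) t + circle_cos (n - m) t).
Proof.
move=> mn; rewrite /circle_cos natrD natrB//.
have -> : 2 * pi * (n%:R + m%:R) * repr t =
  2 * pi * n%:R * repr t + 2 * pi * m%:R * repr t by ring.
have -> : 2 * pi * (n%:R - m%:R) * repr t =
  2 * pi * n%:R * repr t - 2 * pi * m%:R * repr t by ring.
by rewrite cosB cosD; field.
Qed.

Lemma integrable_circle_cos n : lam.-integrable setT (EFin \o circle_cos n).
Proof.
apply: (@bounded_integrable _ _ _ _ _ 1); first exact: measurable_circle_cos.
exact: circle_cos_le1.
Qed.

(* Translation by half a period changes the sign of the cosine. *)
Lemma Rintegral_circle_cos n :
  \int[lam]_t circle_cos n t = (n == 0)%:R.
Proof.
case: n => [|n].
  under eq_Rintegral do rewrite circle_cos0.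
  rewrite Rintegral_cst// mul1r; exact: (congr1 fine (probability_setT lam)).
pose a : R := (2 * n.+1%:R)^-1.
have a01 : 0 <= a <= 1.
  rewrite invr_ge0 mulr_ge0//= invf_le1 ?mulr_gt0//.
  by rewrite -natrM ler1n muln_gt0.
have := Rintegral_measure_preserving (measure_preserving_circle_shift a01)
  (integrable_circle_cos n.+1).
have cosE (t : circle R) :
    circle_cos n.+1 (t + to_circle a) = - 1 * circle_cos n.+1 t.
  rewrite -{1}[t]reprK_circle -to_circleD circle_cos_to_circle mulrDr.
  rewrite (_ : 2 * pi * n.+1%:R * a = pi); first by rewrite cosDpi mulN1r.
  by rewrite /a; field; rewrite nat1r pnatr_eq0.
under eq_Rintegral do rewrite cosE.
rewrite RintegralZl//; first by rewrite /= => ?; lra.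
exact: integrable_circle_cos.
Qed.

(** After the product formula only frequency zero survives integration: for [m <= n], [n - m]
    vanishes when the frequencies agree, [n + m] only when both are zero. Hence the squared norm is
    1 at frequency zero and 1/2 elsewhere. *)
Lemma Rintegral_circle_cosM m n :
  \int[lam]_t (circle_cos m t * circle_cos n t) =
  (m == n)%:R / (1 + (n != 0)%N)%:R.
Proof.
wlog mn : m n / (m <= n)%N => [hw|].
  have [mn|/ltnW nm] := leqP m n; first exact: hw.
  under eq_Rintegral do rewrite mulrC.
  by rewrite hw// eq_sym; case: eqVneq => [->//|]; rewrite !mul0r.
under eq_Rintegral do rewrite circle_cosM//.
rewrite RintegralZl//; last first.
  exact: (integrableD measurableT (integrable_circle_cos _)
    (integrable_circle_cos _)).
rewrite RintegralD//; [|exact: integrable_circle_cos..].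
rewrite !Rintegral_circle_cos subn_eq0 addn_eq0.
have [->|neq] := eqVneq m n.
  rewrite leqnn; case: n mn => [|n] _ /=; last by rewrite add0r mulr1 mul1r.
  by rewrite addn0 divr1 mulVf// pnatr_eq0.
have -> : (n <= m)%N = false.
  by apply/negbTE; rewrite -ltnNge ltn_neqAle neq.
have -> : (n == 0%N) = false.
  by case: n mn neq => // /[!leqn0] /eqP ->.
by rewrite mul0r addr0 mulr0.
Qed.

End circle_trig.

(** The set function is built directly as an integral of [phi]. The formula for integrals against it
    comes from the Radon-Nikodym change of variables, once the derivative is identified with
    [phi]. *)
Lemma density_measure d (T : measurableType d) (R : realType)
    (mu : {finite_measure set T -> \bar R}) (phi : T -> R) (M : R) :
  measurable_fun setT phi -> (forall x, 0 <= phi x <= M) ->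
  exists sigma : {finite_measure set T -> \bar R},
    (forall A, measurable A -> sigma A = \int[mu]_(x in A) (phi x)%:E)%E /\
    forall h : T -> R, measurable_fun setT h -> (forall x, `|h x| <= 1) ->
      \int[sigma]_x h x = \int[mu]_x (h x * phi x).
Proof.
move=> mphi phiM.
have phi0 x : (0 <= (phi x)%:E)%E by rewrite lee_fin; case/andP: (phiM x).
have absphi x : `|phi x| <= M by case/andP: (phiM x) => p0 pM; rewrite ger0_norm.
have mEphi : measurable_fun setT (EFin \o phi) by exact/measurable_EFinP.
have intphi : mu.-integrable setT (EFin \o phi).
  exact: (@bounded_integrable _ _ _ mu phi M).
pose nu := fun A : set T => (\int[mu]_(x in A) (phi x)%:E)%E.
have nu0 : nu set0 = 0%E by rewrite /nu integral_set0.
have nu_ge0 A : (0 <= nu A)%E by exact: integral_ge0.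
have nu_add : semi_sigma_additive nu.
  exact: (semi_sigma_additive_nng_induced (f := EFin \o phi)).
have nu_fin : fin_num_fun nu.
  by move=> A mA; apply: integrable_fin_num => //; exact: integrableS intphi.
pose nuM : {measure set T -> \bar R} :=
  HB.pack nu (isMeasure.Build _ _ _ nu nu0 nu_ge0 nu_add).
pose sigma : {finite_measure set T -> \bar R} :=
  HB.pack (Measure.sort nuM) nuM (Measure_isFinite.Build _ _ _ nuM nu_fin).
exists sigma; split=> // h mh h1.
have sigma_mu : sigma `<< mu.
  apply/null_content_dominatesP => A mA muA0.
  by apply: null_set_integral => //; exact: measurable_funTS.
have inth : sigma.-integrable setT (EFin \o h).
  exact: (@bounded_integrable _ _ _ sigma h 1).
congr fine; rewrite -(Radon_Nikodym_change_of_variables sigma_mu measurableT inth).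
have mRN : measurable_fun setT
    (Radon_Nikodym (charge_of_finite_measure sigma) mu).
  by apply: measurable_int; exact: Radon_Nikodym_integrable.
apply: ae_eq_integral => //.
- by apply: emeasurable_funM => //; exact/measurable_EFinP.
- by apply/measurable_EFinP; exact: measurable_funM.
(* Both functions have integral [sigma A] over every measurable [A], so they agree almost
   everywhere. *)
have phi_RN : ae_eq mu setT (EFin \o phi)
    (Radon_Nikodym (charge_of_finite_measure sigma) mu).
  apply: integral_ae_eq => // A _ mA.
  by rewrite -Radon_Nikodym_integral.
apply: filterS phi_RN => x /(_ I) <- _.
by rewrite EFinM.
Qed.

(** * Sequences with nonnegative Cesaro means *)

Section nonnegative_cesaro_sums.
Context {R : realType}.
Implicit Types a b S : R^nat.

(* Grouping the entries of an N x N Toeplitz matrix by diagonals turns their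
   sum into N times a Cesaro mean. *)
Lemma sum_toeplitz a N :
  \sum_(j < N) \sum_(k < N) a ((j - k) + (k - j))%N =
  series (fun m => series (fun k => (1 + (k != 0))%:R * a k) m.+1) N.
Proof.
elim: N => [|N IH]; first by rewrite big_ord0 /series /= big_geq.
(* Enlarging the matrix adds a row, a column and a corner. They contribute [a 0] plus twice the sum
   of [a 1] up to [a N], which is the next term of the outer series. *)
rewrite seriesSr -IH big_ord_recr /=.
under eq_bigr do rewrite big_ord_recr /=.
rewrite big_split /= -addrA; congr (_ + _).
rewrite big_ord_recr /= subnn addn0.
have rowE (i : 'I_N) : a ((i - N) + (N - i))%N = a (N - i)%N.
  by have := ltn_ord i => /ltnW; rewrite -subn_eq0 => /eqP ->.
have colE (i : 'I_N) : a ((N - i) + (i - N))%N = a (N - i)%N.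
  by rewrite addnC rowE.
rewrite (eq_bigr _ (fun i _ => rowE i)) (eq_bigr _ (fun i _ => colE i)).
have revE : \sum_(i < N) a (N - i)%N = \sum_(i < N) a i.+1.
  rewrite (reindex_inj rev_ord_inj); apply: eq_bigr => i _ /=.
  by rewrite subKn.
rewrite revE /series /= big_mkord big_ord_recl /=.
under [in RHS]eq_bigr do rewrite /bump /= add1n.
by rewrite -big_distrr /= addn0 mul1r; ring.
Qed.

(** A negative value [S m] past [M] would bound all later terms, and the partial sums would decrease
    at least linearly until they became negative. *)
Lemma nonneg_of_cesaro_nonneg S M :
  (forall N, 0 <= series S N) -> (forall m, (M <= m)%N -> S m.+1 <= S m) ->
  forall m, (M <= m)%N -> 0 <= S m.
Proof.
move=> S0 Sni m Mm; rewrite leNgt; apply/negP => Sm.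
have Sle n : S (m + n)%N <= S m.
  elim: n => [|n]; first by rewrite addn0.
  by apply: le_trans; rewrite addnS Sni// (leq_trans Mm)// leq_addr.
have serle n : series S (m + n)%N <= series S m + S m *+ n.
  elim: n => [|n IH]; first by rewrite addn0 mulr0n addr0.
  by rewrite addnS seriesSr mulrSr addrA lerD.
(* More than [series S m / - S m] further terms, each at most [S m], outweigh [series S m]. *)
have := serle (Num.bound (series S m / - S m)).
apply/negP; rewrite -ltNge (lt_le_trans _ (S0 _))//.
rewrite -mulr_natr -ltrBrDl sub0r -ltrN2 opprK -mulNr mulrC -ltr_pdivrMr ?oppr_gt0//.
by apply: archi_boundP; rewrite divr_ge0// oppr_ge0 ltW.
Qed.

(** Past [M] the partial sums of [b] are nonincreasing, hence nonnegative by the previous lemma.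
    Their total decrease, which is the sum of the later absolute values, is therefore at most
    [series b M.+1]. *)
Lemma summable_of_cesaro_nonneg b M :
  (forall k, (M < k)%N -> b k <= 0) ->
  (forall N, 0 <= series (fun m => series b m.+1) N) ->
  exists B, forall n, series (fun k => `|b k|) n <= B.
Proof.
move=> bM S0.
have Snn := @nonneg_of_cesaro_nonneg _ M S0.
have {}Snn m : (M <= m)%N -> 0 <= series b m.+1.
  apply: Snn => k Mk; rewrite [leLHS]seriesSr gerDl; exact: bM.
exists (series (fun k => `|b k|) M.+1 + series b M.+1) => n.
apply: (@le_trans _ _ (series (fun k => `|b k|) (M.+1 + n)%N)).
  rewrite -subr_ge0 sub_series_geq ?leq_addl// sumr_ge0//.
suff -> : series (fun k => `|b k|) (M.+1 + n)%N =
    series (fun k => `|b k|) M.+1 + series b M.+1 - series b (M.+1 + n)%N.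
  by rewrite gerDl oppr_le0 addSn Snn// leq_addr.
elim: n => [|n IH]; first by rewrite !addn0 addrK.
rewrite addnS [LHS]seriesSr IH [series b (_ + n).+1]seriesSr ler0_norm.
  by ring.
by apply: bM; rewrite leq_addr.
Qed.

(** The Cesaro means of [S] are nonnegative and have the same limit [l]. *)
Lemma lim_cesaro_nonneg S l :
  (forall N, 0 <= series S N) -> S @ \oo --> l -> 0 <= l.
Proof.
move=> S0 Sl; have /cvg_lim <- // := cesaro Sl.
apply: limr_ge; first by apply/cvg_ex; exists l; exact: cesaro.
by apply: nearW => n; rewrite /arithmetic_mean /= mulr_ge0.
Qed.

End nonnegative_cesaro_sums.

(** Integrability and value are proved in one induction, since additivity of the integral requires
    the tail to be integrable. *)
Lemma Rintegral_sum d (X : measurableType d) (R : realType)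
    (mu : {measure set X -> \bar R}) (I : Type) (s : seq I) (F : I -> X -> R) :
  (forall i, mu.-integrable setT (EFin \o F i)) ->
  mu.-integrable setT (EFin \o (fun x => \sum_(i <- s) F i x)) /\
  \int[mu]_x (\sum_(i <- s) F i x) = \sum_(i <- s) \int[mu]_x F i x.
Proof.
move=> intF; elim: s => [|i s [ints IH]].
  rewrite big_nil; under eq_Rintegral do rewrite big_nil.
  rewrite /Rintegral integral0; split=> //.
  rewrite (_ : _ \o _ = cst 0%E); first exact: integrable0.
  by apply/funext => x /=; rewrite big_nil.
have sE : (fun x => \sum_(j <- i :: s) F j x) =
    (fun x => F i x + \sum_(j <- s) F j x).
  by apply/funext => x; rewrite big_cons.
rewrite big_cons -IH sE; split; last exact: RintegralD.
exact: (integrableD measurableT (intF i) ints).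
Qed.

(** * Correlations of a stationary process and their positive definiteness *)

Section correlations.
Context d (X : measurableType d) (R : realType).
Variables (mu : probability X R) (T : X -> X).
Hypothesis hT : measure_preserving mu T.
Implicit Types f : X -> R.

Lemma measure_preserving_iter n : measure_preserving mu (iter n T).
Proof.
case: hT => mT invT; elim: n => [|n [mTn invTn]].
  by split=> //; exact: measurable_id.
split; first exact: (measurableT_comp mT mTn).
move=> A mA; have := invTn (T @^-1` A).
rewrite invT// => <-//; rewrite -[X in measurable X]setTI; exact: mT.
Qed.

Lemma Lfun2_comp f n : f \in Lfun mu 2%:E -> f \o iter n T \in Lfun mu 2%:E.
Proof.
move=> f2; have [mTn invTn] := measure_preserving_iter n.
have mf : measurable_fun setT f by move: f2 => /andP[/set_mem].
apply/andP; split; rewrite inE/=; first exact: (measurableT_comp mf mTn).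
rewrite /finite_norm unlock /Lnorm poweR_lty//.
have := Lfun_integrable (ler1n R 2) f2.
move=> /(integrable_measure_preserving (measure_preserving_iter n)).
exact: integrable_lty.
Qed.

Lemma integrable_correlation f m n : f \in Lfun mu 2%:E ->
  mu.-integrable setT (EFin \o (fun x => f (iter m T x) * f (iter n T x))).
Proof.
move=> f2; apply/Lfun1_integrable.
exact: (Lfun2_mul_Lfun1 (Lfun2_comp m f2) (Lfun2_comp n f2)).
Qed.

(** Stationarity: the smaller power of [T] is removed by invariance. The sum of the two truncated
    differences is the distance between [m] and [n]. *)
Lemma Rintegral_correlation f m n : f \in Lfun mu 2%:E ->
  \int[mu]_x (f (iter m T x) * f (iter n T x)) =
  correlation mu T f ((m - n) + (n - m))%N.
Proof.
move=> f2; wlog mn : m n / (m <= n)%N => [hw|].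
  have [mn|/ltnW nm] := leqP m n; first exact: hw.
  by under eq_Rintegral do rewrite mulrC; rewrite hw// addnC.
have := mn; rewrite -subn_eq0 => /eqP ->; rewrite add0n /correlation.
rewrite -[RHS](Rintegral_measure_preserving (measure_preserving_iter m)).
  by apply: eq_Rintegral => x _; rewrite -iterD subnK.
exact: (integrable_correlation 0 (n - m) f2).
Qed.

(** The form is the integral of the square of the combination of the [f (iter j T x)] with
    coefficients [u j]. *)
Lemma correlation_quadratic_ge0 f N (u : 'I_N -> R) : f \in Lfun mu 2%:E ->
  0 <= \sum_(j < N) \sum_(k < N)
         u j * u k * correlation mu T f ((j - k) + (k - j))%N.
Proof.
move=> f2.
pose h j x := u j * f (iter j T x).
have inth (j k : 'I_N) :
    mu.-integrable setT (EFin \o (fun x => h j x * h k x)).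
  rewrite (_ : (fun x => h j x * h k x) =
      (fun x => u j * u k * (f (iter j T x) * f (iter k T x)))).
    exact: (integrableZl measurableT _ (integrable_correlation j k f2)).
  by apply/funext => x; rewrite /h; ring.
rewrite (_ : \sum_(j < N) _ = \int[mu]_x ((\sum_(j < N) h j x) ^+ 2)).
  by apply: Rintegral_ge0 => x _; rewrite sqr_ge0.
under eq_Rintegral do rewrite expr2 big_distrlr/=.
rewrite (Rintegral_sum _ _).2; last first.
  by move=> j; exact: (Rintegral_sum _ (inth j)).1.
apply: eq_bigr => j _; rewrite (Rintegral_sum _ _).2//.
apply: eq_bigr => k _; rewrite -Rintegral_correlation//.
rewrite -RintegralZl//; last exact: integrable_correlation.
by apply: eq_Rintegral => x _; rewrite /h; ring.
Qed.

(** The formula for the cosine of a difference splits this into two real quadratic forms, with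
    cosine and with sine coefficients; this replaces complex exponentials. *)
Lemma correlation_toeplitz_ge0 f N (t : circle R) : f \in Lfun mu 2%:E ->
  0 <= \sum_(j < N) \sum_(k < N)
         circle_cos ((j - k) + (k - j))%N t *
         correlation mu T f ((j - k) + (k - j))%N.
Proof.
move=> f2.
have cosE (j k : nat) : circle_cos ((j - k) + (k - j))%N t =
    circle_cos j t * circle_cos k t + circle_sin j t * circle_sin k t.
  wlog jk : j k / (j <= k)%N => [hw|].
    have [jk|/ltnW kj] := leqP j k; first exact: hw.
    by rewrite addnC hw//; congr (_ + _); rewrite mulrC.
  have := jk; rewrite -subn_eq0 => /eqP ->; rewrite add0n.
  rewrite /circle_cos /circle_sin natrB//.
  rewrite (_ : _ * _ * _ = 2 * pi * k%:R * repr t - 2 * pi * j%:R * repr t).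
    by rewrite cosB; ring.
  by ring.
under eq_bigr do under eq_bigr do rewrite cosE mulrDl.
under eq_bigr do rewrite big_split/=.
by rewrite big_split/= addr_ge0// correlation_quadratic_ge0.
Qed.

Lemma Lfun2_integrable f : f \in Lfun mu 2%:E ->
  mu.-integrable setT (EFin \o f).
Proof.
move=> f2; apply/Lfun1_integrable/(Lfun_subset12 _ f2).
by rewrite fin_num_measure.
Qed.

Lemma correlation_center f n : f \in Lfun mu 2%:E ->
  correlation mu T (fun x => f x - \int[mu]_x f x) n =
  correlation mu T f n - (\int[mu]_x f x) ^+ 2.
Proof.
move=> f2; set m := \int[mu]_x f x.
have intc (c : R) : mu.-integrable setT (EFin \o cst c).
  exact: finite_measure_integrable_cst.
have intf := Lfun2_integrable f2.
have intfn := Lfun2_integrable (Lfun2_comp n f2).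
have intp := integrable_correlation 0 n f2.
have intm (h : X -> R) : mu.-integrable setT (EFin \o h) ->
    mu.-integrable setT (EFin \o (fun x => m * h x)).
  by move=> inth; exact: (integrableZl measurableT m inth).
rewrite /correlation.
transitivity (\int[mu]_x ((f x * f (iter n T x) - m * f x) -
    (m * f (iter n T x) - m ^+ 2))).
  by apply: eq_Rintegral => x _; ring.
rewrite RintegralB//; last 2 first.
- exact: (integrableB measurableT intp (intm _ intf)).
- exact: (integrableB measurableT (intm _ intfn) (intc _)).
rewrite RintegralB//; last exact: intm.
rewrite RintegralB//; [|exact: intm|exact: intc].
rewrite RintegralZl// RintegralZl// Rintegral_cst//.
rewrite (Rintegral_measure_preserving (measure_preserving_iter n) intf) -/m.
have -> : fine (mu setT) = 1 by rewrite probability_setT.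
ring.
Qed.

Lemma Lfun2_center f : f \in Lfun mu 2%:E ->
  (fun x => f x - \int[mu]_x f x) \in Lfun mu 2%:E.
Proof.
move=> f2; have p1 : (1 <= 2%:E :> \bar R)%E by rewrite lee_fin ler1n.
exact: ((Lfun_addr_closed mu p1).2 f _ f2 (Lfun_cst mu (- \int[mu]_x f x) 2)).
Qed.

Lemma ae_eq0_of_correlation0 f : f \in Lfun mu 2%:E ->
  correlation mu T f 0 = 0 -> {ae mu, forall x, f x = 0}.
Proof.
move=> f2 c0; have int2 := Lfun2_integrable_sqr f2.
have : (\int[mu]_x `|(f x ^+ 2)%:E| = 0)%E.
  under eq_integral do rewrite gee0_abs ?lee_fin ?sqr_ge0//.
  rewrite -[LHS]fineK; last exact: integrable_fin_num.
  by congr EFin; rewrite -[RHS]c0.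
move/(ae_eq_integral_abs mu measurableT (measurable_int mu int2)).1.
by apply: filterS => x /(_ I) [] /eqP; rewrite sqrf_eq0 => /eqP.
Qed.

End correlations.

(** * The absolutely continuous spectral measure, and the conclusion *)

Lemma summable_spectral_measure d (X : measurableType d) (R : realType)
    (mu : probability X R) (T : X -> X) (f : X -> R) (M : nat) :
  measure_preserving mu T -> f \in Lfun mu 2%:E ->
  (forall k, (M < k)%N -> correlation mu T f k <= 0) ->
  exists sigma : {finite_measure set (circle R) -> \bar R},
    is_spectral_measure mu T f sigma /\ sigma `<< @circle_lebesgue R.
Proof.
move=> hT f2 cM.
pose c := correlation mu T f.
(* The weight is 2 for [k != 0] because the frequencies [k] and [-k] are merged into one cosine. *)
pose w (k : nat) : R := (1 + (k != 0))%:R.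
pose b (t : circle R) (k : nat) := w k * (circle_cos k t * c k).
have S_ge0 t N : 0 <= series (fun m => series (b t) m.+1) N.
  by rewrite -(sum_toeplitz (fun k => circle_cos k t * c k))
    correlation_toeplitz_ge0.
have cos0E k : circle_cos k (to_circle (0 : R)) = 1.
  by rewrite circle_cos_to_circle mulr0 cos0.
(* At the point 0 every cosine is 1, so the terms inherit the signs of the correlations. The bound
   found there dominates the series at every [t]. *)
have [B b0B] : exists B : R, forall n,
    series (fun k => `|b (to_circle (0 : R)) k|) n <= B.
  apply: (@summable_of_cesaro_nonneg _ _ M) => // k Mk.
  by rewrite /b cos0E mul1r mulr_ge0_le0// cM.
have bB t n : series (fun k => `|b t k|) n <= B.
  apply: le_trans (b0B n); apply: ler_sum => k _.
  rewrite /b cos0E mul1r !normrM ler_wpM2l//.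
  by apply: ler_piMl => //; exact: circle_cos_le1.
have SB t n : `|series (b t) n| <= B.
  exact: le_trans (ler_norm_sum _ _ _) (bB t n).
have cvgS t : cvgn (series (b t)).
  apply: normed_cvg; apply: nondecreasing_is_cvgn.
    apply/nondecreasing_seqP => n; rewrite /= [leRHS]seriesSr lerDl//.
  by exists B => _ [n _ <-]; exact: bB.
pose phi t := limn (series (b t)).
have Sphi t : series (b t) @ \oo --> phi t by exact: cvgS.
have phiB t : 0 <= phi t <= B.
  (* Nonnegativity passes from the Cesaro means to the limit, whereas individual partial sums may be
     negative. *)
  apply/andP; split.
    by apply: (lim_cesaro_nonneg (S_ge0 t)); rewrite cvg_shiftS.
  apply: limr_le => //; apply: nearW => n.
  exact: le_trans (ler_norm _) (SB t n).
have mS n : measurable_fun setT (fun t => series (b t) n).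
  rewrite (_ : (fun t => _) = fun t => \sum_(0 <= k < n) b t k)//.
  apply: measurable_sum => k; apply: measurable_funM => //.
  by apply: measurable_funM => //; exact: measurable_circle_cos.
have mphi : measurable_fun setT phi.
  by apply: (@measurable_fun_cvg _ _ _ _ (fun n t => series (b t) n)).
have phiN t : phi (- t) = phi t.
  congr (limn (series _)).
  by apply/funext => k; rewrite /b circle_cosN.
have intphi : (@circle_lebesgue R).-integrable setT (EFin \o phi).
  apply: (@bounded_integrable _ _ _ _ _ B) => // t.
  by case/andP: (phiB t) => p0 pB; rewrite ger0_norm.
have [sigma [sigmaE intsigma]] :=
  @density_measure _ _ _ (@circle_lebesgue R) phi B mphi phiB.
exists sigma; split; last first.
  apply/null_content_dominatesP => A mA A0; rewrite sigmaE//.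
  apply: null_set_integral => //; apply/measurable_funTS.
  exact/measurable_EFinP.
split=> [A mA|n].
  have mNA : measurable ((fun t : circle R => - t) @^-1` A).
    by rewrite -[X in measurable X]setTI; exact: measurable_circle_opp.
  rewrite !sigmaE//.
  rewrite -[RHS](integral_measure_preserving measure_preserving_circle_opp)//.
  by apply: eq_integral => t _; rewrite /= phiN.
rewrite (intsigma _ (@measurable_circle_cos R n) (@circle_cos_le1 R n)).
rewrite (intsigma _ (@measurable_circle_sin R n) (@circle_sin_le1 R n)).
split; last first.
  (* This function is odd, as [phi] is even; invariance under negation makes its integral equal to
     its own opposite. *)
  pose h t := circle_sin n t * phi t.
  have inth : (@circle_lebesgue R).-integrable setT (EFin \o h).
    apply: (@bounded_integrable _ _ _ _ _ B) => [|t].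
      by apply: measurable_funM => //; exact: measurable_circle_sin.
    case/andP: (phiB t) => p0 pB.
    rewrite normrM (ger0_norm p0) (le_trans _ pB)// ler_piMl//.
    exact: circle_sin_le1.
  have := Rintegral_measure_preserving measure_preserving_circle_opp inth.
  under eq_Rintegral do rewrite /h circle_sinN phiN mulNr -mulN1r.
  by rewrite RintegralZl// => intN; rewrite -/(h _) in intN *; lra.
(* By orthogonality only the term of index [n] remains, present once [n < m]; the weight [w n]
   cancels the squared norm of the cosine. *)
have cosS m : (n < m)%N ->
    \int[@circle_lebesgue R]_t (circle_cos n t * series (b t) m) = c n.
  move=> nm.
  have E t : circle_cos n t * series (b t) m =
      \sum_(k < m) w k * c k * (circle_cos n t * circle_cos k t).
    rewrite /series /= big_mkord big_distrr/=; apply: eq_bigr => k _.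
    by rewrite /b; ring.
  under eq_Rintegral do rewrite E.
  have intnk k : (@circle_lebesgue R).-integrable setT
      (EFin \o (fun t => circle_cos n t * circle_cos k t)).
    apply: (@bounded_integrable _ _ _ _ _ 1) => [|t].
      by apply: measurable_funM; exact: measurable_circle_cos.
    by rewrite normrM mulr_ile1// circle_cos_le1.
  rewrite (Rintegral_sum _ _).2; last first.
    by move=> k; exact: (integrableZl measurableT (w k * c k) (intnk k)).
  under eq_bigr do rewrite RintegralZl// Rintegral_circle_cosM.
  rewrite (bigD1 (Ordinal nm))//= eqxx big1 ?addr0 => [|k].
    by rewrite mul1r mulrAC mulfV ?mul1r// pnatr_eq0.
  by rewrite -val_eqE/= eq_sym => /negbTE ->; rewrite mul0r mulr0.
have intcosS m : (@circle_lebesgue R).-integrable setT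
    (EFin \o (fun t => circle_cos n t * series (b t) m)).
  apply: (@bounded_integrable _ _ _ _ _ B) => [|t].
    by apply: measurable_funM => //; exact: measurable_circle_cos.
  rewrite normrM (le_trans _ (SB t m))// ler_piMl//; exact: circle_cos_le1.
(* The uniform bound [B] allows passing from the partial sums to [phi]. The integrals are constantly
   [c n] from index [n.+1] on, so this is also their limit. *)
have [|||||_ _ cvgint] := @dominated_convergence _ _ _ (@circle_lebesgue R)
  setT measurableT
  (fun m t => (circle_cos n t * series (b t) m)%:E)
  (fun t => (circle_cos n t * phi t)%:E) (cst B%:E).
- by move=> m; exact: measurable_int (intcosS m).
- apply/measurable_EFinP; apply: measurable_funM => //.
  exact: measurable_circle_cos.
- apply: aeW => t _; apply: cvg_EFin; first exact: nearW.
  by apply: cvgM; [exact: cvg_cst|exact: Sphi].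
- exact: finite_measure_integrable_cst.
- apply: aeW => t m _; rewrite lee_fin normrM (le_trans _ (SB t m))//.
  by rewrite ler_piMl//; exact: circle_cos_le1.
rewrite /Rintegral -[RHS]/(fine (c n)%:E); congr fine.
apply: (cvg_unique _ cvgint) => //; apply: cvg_near_cst.
exists n.+1 => // m nm /=.
rewrite -(cosS m nm) /Rintegral fineK//.
exact: (integrable_fin_num measurableT (intcosS m)).
Qed.

Lemma infinitely_many_correlations_gt d (X : measurableType d) (R : realType)
    (mu : probability X R) (T : X -> X) (f : X -> R) :
  measure_preserving mu T -> singular_maximal_spectral_type mu T ->
  f \in Lfun mu 2%:E -> ~ ae_constant mu f ->
  infinite_set [set n : nat | (0 < n)%N /\
    correlation mu T f n > (\int[mu]_x f x) ^+ 2].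
Proof.
move=> hT hsing f2 fnc /finite_seqP[s sE]; apply: fnc.
pose g x := f x - \int[mu]_x f x.
have g2 : g \in Lfun mu 2%:E by exact: Lfun2_center.
(* The list [s] enumerates the supposedly finite set of exceptional times, so past its maximum the
   centred correlations are nonpositive. *)
have gM k : (\max_(i <- s) i < k)%N -> correlation mu T g k <= 0.
  move=> sk; rewrite correlation_center// subr_le0 leNgt; apply/negP => fk.
  have : [set` s] k by rewrite -sE; split=> //; exact: leq_ltn_trans sk.
  move=> /= ks; have := @leq_bigmax_seq _ s xpredT id k ks isT.
  by rewrite leqNgt sk.
have [sigma [spec dom]] := summable_spectral_measure hT g2 gM.
have [A [mA sA lA]] := hsing g g2 sigma spec.
(* Singularity makes [sigma] vanish on [A] and Lebesgue measure vanish on its complement; by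
   absolute continuity [sigma] vanishes there too. *)
have sCA : sigma (~` A) = 0%E.
  exact: ((null_content_dominatesP _ _).1 dom _ (measurableC mA) lA).
have sigma0 : sigma setT = 0%E.
  transitivity (sigma A + sigma (~` A))%E; last by rewrite sA sCA adde0.
  rewrite -(setUv A); apply: measureU => //; [exact: measurableC|].
  exact: setICr.
(* The coefficient of index 0 is the total mass of [sigma]. *)
have c0 : correlation mu T g 0 = 0.
  rewrite -(spec.2 0%N).1; under eq_Rintegral do rewrite circle_cos0.
  by rewrite Rintegral_cst// mul1r; exact: (congr1 fine sigma0).
exists (\int[mu]_x f x).
by apply: filterS (ae_eq0_of_correlation0 g2 c0) => x /eqP; rewrite subr_eq0 => /eqP.
Qed.

Unset Implicit Arguments.

Theorem mainTheorem11 (R : realType) (d : measure_display)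
    (X : measurableType d) (mu : probability X R) (T : X -> X)
    (hT : measure_preserving mu T)
    (hsing : singular_maximal_spectral_type mu T) :
  (~ exists f : X -> R, under_recurrent mu T f) /\
  (forall f : X -> R, f \in Lfun mu 2%:E -> ~ ae_constant mu f ->
     infinite_set
       [set n : nat | (0 < n)%N /\
          correlation mu T f n > (\int[mu]_x f x) ^+ 2]).
Proof.
split=> [[f [f2 fnc fle]]|f]; last exact: infinitely_many_correlations_gt.
(* Under-recurrence would leave no exceptional time at all, and the empty set is finite. *)
apply: (infinitely_many_correlations_gt hT hsing f2 fnc).
rewrite (_ : [set _ | _] = set0)//.
by apply/seteqP; split=> // n /= [n0]; rewrite ltNge fle.
Qed.
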